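(* Let $\mathbb{P}$ be a $\sigma$-finite stationary measure on $(\Omega,\mathcal{F})$. Let $\xi$ and $\eta$ be two invariant random measures on $G$ and let $T$ be an invariant weighted transport-kernel. Then $T$ is $\mathbb{P}$-a.e. $(\xi,\eta)$-balancing if and only if $$\mathbb{E}_{\mathbb{P}_\xi}\left[\int f(\theta_t)\,T(0,dt)\right]=\mathbb{E}_{\mathbb{P}_\eta}[f]$$ holds for all measurable $f:\Omega\to[0,\infty)$.
   Context: $G$ is a locally compact, second countable Hausdorff topological Abelian group with neutral element $0$, Borel $\sigma$-field $\mathcal{G}$ and fixed Haar measure $\lambda$. $\mathbf{M}$ is the set of locally finite measures on $G$ (finite on compact sets), with the $\sigma$-field generated by the maps $\mu\mapsto\mu(B)$, $B\in\mathcal{G}$. $(\Omega,\mathcal{F})$ is a measurable space equipped with a measurable flow $\theta_s:\Omega\to\Omega$, $s\in G$: $(\omega,s)\mapsto\theta_s\omega$ is measurable, $\theta_0$ is the identity, and $\theta_s\circ\theta_t=\theta_{s+t}$ for all $s,t\in G$. A measure $\mathbb{P}$ on $(\Omega,\mathcal{F})$ is stationary if it is invariant under every $\theta_s$, $s\in G$. A random measure on $G$ is a measurable map $\xi:\Omega\to\mathbf{M}$, written $\xi(\omega,B):=\xi(\omega)(B)$; it is invariant if $\xi(\theta_s\omega,B-s)=\xi(\omega,B)$ for all $\omega\in\Omega$, $s\in G$, $B\in\mathcal{G}$. A weighted transport-kernel is a kernel $T$ from $\Omega\times G$ to $G$ such that $T(\omega,s,\cdot)$ is locally finite for all $(\omega,s)$.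 It is invariant if $T(\theta_t\omega,s-t,B-t)=T(\omega,s,B)$ for all $s,t\in G$, $\omega\in\Omega$, $B\in\mathcal{G}$. One writes $T(s,\cdot)$ for $T(\theta_0,s,\cdot)$, i.e. $\omega\mapsto T(\omega,s,\cdot)$. $T$ is $\mathbb{P}$-a.e. $(\xi,\eta)$-balancing if $\int T(\omega,s,\cdot)\,\xi(\omega,ds)=\eta(\omega,\cdot)$ for $\mathbb{P}$-a.e. $\omega\in\Omega$. For $\sigma$-finite stationary $\mathbb{P}$ and an invariant random measure $\xi$, the Palm measure $\mathbb{P}_\xi$ of $\xi$ (with respect to $\mathbb{P}$) is the ($\sigma$-finite) measure on $(\Omega,\mathcal{F})$ given by $$\mathbb{P}_\xi(A):=\lambda(B)^{-1}\iint \mathbf{1}_A(\theta_s\omega)\mathbf{1}_B(s)\,\xi(\omega,ds)\,\mathbb{P}(d\omega),\qquad A\in\mathcal{F},$$ for any $B\in\mathcal{G}$ with $0<\lambda(B)<\infty$ (the definition does not depend on $B$). $\mathbb{E}_{\mathbb{Q}}$ denotes integration with respect to a measure $\mathbb{Q}$ on $(\Omega,\mathcal{F})$; the argument $\omega$ is suppressed, e.g. $f(\theta_t)$ stands for $\omega\mapsto f(\theta_t\omega)$. *)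

(* Defs.v *)
From HB Require Import structures.
From mathcomp Require Import all_boot all_order all_algebra.
From mathcomp Require Import all_classical all_reals all_analysis.
From mathcomp Require Import measurable_realfun.

Set Implicit Arguments.
Unset Strict Implicit.
Unset Printing Implicit Defensive.

Import Order.TTheory GRing.Theory Num.Theory.
Import numFieldNormedType.Exports.

Local Open Scope classical_set_scope.
Local Open Scope ring_scope.
Local Open Scope ereal_scope.

(* [borel G] is a copy of the topological group [G] carrying its Borel
   sigma-field. The copy is needed because a [topologicalZmodType] is not
   pointed, which [measurableType] requires; its point is 0. *)
Definition borel (G : topologicalZmodType) : Type := G.

HB.instance Definition _ (G : topologicalZmodType) :=
  TopologicalZmodule.copy (borel G) G.
HB.instance Definition _ (G : topologicalZmodType) :=
  isPointed.Build (borel G) (0%R : G).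

Section borel_sigma_field.
Variable G : topologicalZmodType.

Let borel_sigma : set (set (borel G)) := <<s @open (borel G) >>.

Let borel_sigma0 : borel_sigma set0.
Proof. exact: sigma_algebra0. Qed.

Let borel_sigmaC (A : set (borel G)) : borel_sigma A -> borel_sigma (~` A).
Proof. exact: sigma_algebraC. Qed.

Let borel_sigmaU (F : (set (borel G))^nat) :
  (forall i, borel_sigma (F i)) -> borel_sigma (\bigcup_i F i).
Proof. exact: sigma_algebra_bigcup. Qed.

HB.instance Definition _ := @isMeasurable.Build (sigma_display (@open (borel G)))
  (borel G) borel_sigma borel_sigma0 borel_sigmaC borel_sigmaU.

End borel_sigma_field.

Definition lcsch (G : topologicalZmodType) : Prop :=
  [/\ locally_compact [set: G], @second_countable G & hausdorff_space G].

Definition shift_sub (G : topologicalZmodType) (B : set (borel G))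
    (s : borel G) : set (borel G) :=
  [set (b - s)%R | b in B].

Section locally_finite_measures.
Variables (G : topologicalZmodType) (R : realType).

Definition locally_finite (mu : set (borel G) -> \bar R) : Prop :=
  forall K : set (borel G), compact K -> mu K < +oo.

(* Regularity is not required: on a locally compact, second countable Hausdorff
   space every locally finite Borel measure is regular. *)
Definition haar_measure (lambda : {measure set (borel G) -> \bar R}) : Prop :=
  [/\ locally_finite lambda,
      lambda [set: borel G] != 0 &
      forall (s : borel G) (B : set (borel G)),
        measurable B -> lambda (shift_sub B s) = lambda B].

(* A [{measure set T -> \bar R}] is a function on all subsets of [T],
   unspecified outside of the sigma-field: equalities between measures below
   are always stated on measurable sets. *)
Record lfmeasure : Type := LFMeasure {
  lfmeasure_measure :> {measure set (borel G) -> \bar R} ;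
  lfmeasureP : locally_finite lfmeasure_measure }.

Let mzero_locally_finite : locally_finite (@mzero _ (borel G) R).
Proof. by move=> K _; rewrite /mzero ltry. Qed.

HB.instance Definition _ := gen_eqMixin lfmeasure.
HB.instance Definition _ := gen_choiceMixin lfmeasure.
HB.instance Definition _ :=
  isPointed.Build lfmeasure (LFMeasure mzero_locally_finite).

Definition lfmeasure_gen : set (set lfmeasure) :=
  \bigcup_(B in (measurable : set (set (borel G))))
    preimage_set_system [set: lfmeasure]
      (fun mu : lfmeasure => mu B) measurable.

Let lfmeasure_sigma : set (set lfmeasure) := <<s lfmeasure_gen >>.

Let lfmeasure_sigma0 : lfmeasure_sigma set0.
Proof. exact: sigma_algebra0. Qed.

Let lfmeasure_sigmaC (A : set lfmeasure) :
  lfmeasure_sigma A -> lfmeasure_sigma (~` A).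
Proof. exact: sigma_algebraC. Qed.

Let lfmeasure_sigmaU (F : (set lfmeasure)^nat) :
  (forall i, lfmeasure_sigma (F i)) -> lfmeasure_sigma (\bigcup_i F i).
Proof. exact: sigma_algebra_bigcup. Qed.

HB.instance Definition _ := @isMeasurable.Build (sigma_display lfmeasure_gen)
  lfmeasure lfmeasure_sigma lfmeasure_sigma0 lfmeasure_sigmaC lfmeasure_sigmaU.

End locally_finite_measures.

Section flow.
Context (R : realType) (G : topologicalZmodType) (d : measure_display)
  (Omega : measurableType d).
Implicit Types (theta : borel G -> Omega -> Omega)
  (P : {measure set Omega -> \bar R}) (lambda : {measure set (borel G) -> \bar R})
  (xi eta : Omega -> lfmeasure G R) (T : R.-ker (Omega * borel G) ~> borel G).

Definition measurable_flow theta : Prop :=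
  [/\ measurable_fun [set: Omega * borel G]
        (fun p : Omega * borel G => theta p.2 p.1),
      forall w, theta 0%R w = w &
      forall s t w, theta s (theta t w) = theta (s + t)%R w].

Definition stationary theta P : Prop :=
  forall (s : borel G) (A : set Omega),
    measurable A -> P (theta s @^-1` A) = P A.

Definition invariant_random_measure theta xi : Prop :=
  forall w (s : borel G) (B : set (borel G)),
    measurable B -> xi (theta s w) (shift_sub B s) = xi w B.

Definition weighted_transport_kernel T : Prop :=
  forall (w : Omega) (s : borel G), locally_finite (T (w, s)).

Definition invariant_transport_kernel theta T : Prop :=
  forall (s t : borel G) w (B : set (borel G)),
    measurable B -> T (theta t w, (s - t)%R) (shift_sub B t) = T (w, s) B.

Definition ae_balancing P xi eta T : Prop :=
  {ae P, forall w, forall B : set (borel G), measurable B ->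
    \int[xi w]_s T (w, s) B = eta w B}.

(* The Palm measure, written with a reference set [B] of positive finite Haar
   measure, on which its values do not depend. It is given as a set function,
   which is all that the integral [\int[_]__ _] requires. *)
Definition palm theta lambda P (B : set (borel G)) xi (A : set Omega) : \bar R :=
  (lambda B)^-1 *
  \int[P]_w \int[xi w]_s (\1_A (theta s w) * \1_B s)%:E.

End flow.

(* Main.v *)
Require Import Defs.
From HB Require Import structures.
From mathcomp Require Import all_boot all_order all_algebra.
From mathcomp Require Import all_classical all_reals all_analysis.
From mathcomp Require Import measurable_realfun.

Set Implicit Arguments.
Unset Strict Implicit.
Unset Printing Implicit Defensive.

Import Order.TTheory GRing.Theory Num.Theory.
Import numFieldNormedType.Exports.

Local Open Scope classical_set_scope.
Local Open Scope ring_scope.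
Local Open Scope ereal_scope.

(** Why the theorem is true.

    Write [eta'] for the kernel [w |-> \int T (w, s) xi w (ds)]; balancing means
    that [eta'] and [eta] agree almost everywhere. Since [T] is invariant,
    [\int f (theta_t (theta_s w)) T (theta_s w, 0) (dt)] equals
    [\int f (theta_t w) T (w, s) (dt)], so the left-hand side of the Palm
    identity counts the mass sent by [T] out of the sources [s] in [B], weighted
    by [f (theta_t w)], where [t] is the target. A mass transport principle lets
    one count the same mass by its targets in [C] instead
    ([mass_transport], [source_target_exchange]), and so turns the left-hand
    side into a Palm integral of [eta'] ([integral_palm_transport]). Hence the
    Palm identity says that [eta'] and [eta] have the same Palm measure, which
    gives the direct implication at once ([balancing_palm]).

    For the converse it remains to recover an invariant kernel [zeta], up to a
    null set, from its Palm measure. By the refined Campbell formula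
    ([refined_campbell]) the Palm measure determines
    [\int \int k (theta_t w, t) zeta w (dt) P (dw)] for every [k >= 0]; taking
    [k (w, t) = 1_A (theta_{-t} w) 1_D (t)] it determines
    [\int_A zeta w D P (dw)] for every event [A] and every relatively compact
    [D]. As [eta w D] is finite this pins down [zeta w D] for almost every [w]
    and each fixed [D], and a countable pi-system of sets [D] makes the null set
    independent of [D] ([ae_eq_kernel]).

    The mass transport principle is Tonelli's theorem: a quantity over a
    shift-invariant measure [M] is averaged over a group element [u] distributed
    by Haar measure, and the system is shifted by [u] before integrating in the
    other order. The shift reverses the sign of [u], which is harmless because
    Haar measure on an Abelian group is invariant under reflection
    ([integral_reflect]). Tonelli's theorem needs s-finiteness, which follows
    from local finiteness because [G] is a countable union of compact sets
    ([locally_finite_kernel_sfinite]). *)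

(** * Cancellation in the extended reals, integrals and set functions *)

Lemma mule_cancelI (R : realType) (a x y : \bar R) :
  0 < a < +oo -> a * x = a * y -> x = y.
Proof.
case: a => [a| |]; rewrite ?ltxx ?andbF//.
rewrite lte_fin ltry andbT => a0 /(congr1 (fun z => a^-1%:E * z)).
by rewrite !muleA -!EFinM mulVf ?gt_eqF// !mul1e.
Qed.

Lemma inve_between (R : realType) (a : \bar R) : 0 < a < +oo -> 0 < a^-1 < +oo.
Proof.
case: a => [a| |]; rewrite ?ltxx ?andbF//.
by rewrite lte_fin ltry andbT => a0; rewrite inver gt_eqF// ltry lte_fin invr_gt0 a0.
Qed.

Lemma mule_cross (R : realType) (a b x y : \bar R) :
  0 < a < +oo -> 0 < b < +oo -> b * x = a * y -> a^-1 * x = b^-1 * y.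
Proof.
case: a => [a| |]; rewrite ?ltxx ?andbF//; case: b => [b| |]; rewrite ?ltxx ?andbF//.
rewrite !lte_fin !ltry !andbT => a0 b0 bxay; rewrite !inver !gt_eqF//.
have -> : x = b^-1%:E * (a%:E * y).
  by rewrite -bxay muleA -EFinM mulVf ?gt_eqF// mul1e.
by rewrite muleCA (muleA a^-1%:E) -EFinM mulVf ?gt_eqF// mul1e.
Qed.

Lemma measurable_EFin_indic d (X : measurableType d) (R : realType) (D : set X) :
  measurable D -> measurable_fun [set: X] (fun x => (\1_D x : R)%:E).
Proof. by move=> mD; apply/measurable_EFinP; exact: measurable_indic. Qed.

Section integrals_and_set_functions.
Context d (X : measurableType d) (R : realType).

Import HBNNSimple.

(** The integral evaluates its set function on preimages of points under simple
    functions only. No additivity is assumed, so that this applies to a set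
    function, such as the Palm one, that is a measure on the sigma-field only. *)
Lemma eq_set_function_integral (m1 m2 : set X -> \bar R) (f : X -> \bar R) :
  (forall A, measurable A -> m1 A = m2 A) -> \int[m1]_x f x = \int[m2]_x f x.
Proof.
move=> m12; rewrite /integral.
have E (h : {nnsfun X >-> R}) : sintegral m1 h = sintegral m2 h.
  by apply: eq_fsbigr => r _; rewrite m12.
by congr (ereal_sup _ - ereal_sup _); apply/seteqP;
  split=> _ [h hf <-]; exists h; rewrite ?E.
Qed.

Lemma ge0_integral_mrestr (m : {measure set X -> \bar R}) (D : set X)
    (mD : measurable D) (f : X -> \bar R) :
  (forall x, 0 <= f x) -> measurable_fun [set: X] f ->
  \int[mrestr m mD]_x f x = \int[m]_(x in D) f x.
Proof.
move=> f0 mf; rewrite -[X in integral _ X](setUv D) ge0_integral_setU//.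
- rewrite [X in _ + X](_ : _ = 0) ?adde0; last first.
    rewrite -[RHS](@integral_measure_zero _ X R (~` D) f).
    apply: eq_measure_integral => A mA AD.
    transitivity (m (A `&` D)); first by [].
    rewrite (_ : A `&` D = set0) ?measure0//.
    by rewrite -subset0 => x [/AD].
  apply: eq_measure_integral => A mA AD.
  transitivity (m (A `&` D)); first by [].
  by rewrite setIidl.
- exact: measurableC.
- exact: measurable_funTS.
- by rewrite disj_set2E setICr.
Qed.

End integrals_and_set_functions.

(** * The Borel sigma-field of the group *)

Section borel_topology.
Context (G : topologicalZmodType).
Hypothesis hG : lcsch G.

Lemma open_borel_measurable (U : set (borel G)) : open U -> measurable U.
Proof. by move=> oU; exact: sub_sigma_algebra. Qed.

Lemma closed_borel_measurable (F : set (borel G)) : closed F -> measurable F.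
Proof.
move=> cF; rewrite -(setCK F); apply: measurableC; apply: open_borel_measurable.
exact: closed_openC.
Qed.

Lemma compact_borel_measurable (K : set (borel G)) : compact K -> measurable K.
Proof.
case: hG => _ _ hsd cK; apply: closed_borel_measurable.
exact: (@compact_closed (borel G)).
Qed.

(** A base of the topology listed by the integers; an index that codes no member
    of the base stands for the empty set. *)
Lemma countable_base : exists V : nat -> set (borel G),
  (forall n, open (V n)) /\
  (forall (x : borel G) (A : set (borel G)), nbhs x A ->
     exists n, V n x /\ V n `<=` A).
Proof.
case: hG => _ [B /countable_injP[f finj] [oB bB]] _.
exists (fun n => \bigcup_(W in [set W | B W /\ f W = n]) W); split.
  by move=> n; apply: bigcup_open => W [BW _]; exact: oB.
move=> x A /bB[W [BW Wx] WA]; exists (f W); split; first by exists W.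
move=> y [W' [BW' ff] W'y]; apply: WA => /=.
by rewrite -(finj _ _ _ _ ff) ?inE.
Qed.

(** Continuity alone only makes the preimage of an open set open in the product.
    Second countability writes it as a countable union of open rectangles, which
    belongs to the product of the two Borel sigma-fields. *)
Lemma measurable_fun_sub :
  measurable_fun [set: borel G * borel G]
    (fun p : borel G * borel G => (p.1 - p.2)%R : borel G).
Proof.
have [V [oV bV]] := countable_base.
apply: (@measurability _ _ _ _ _ _ (@open (borel G))) => //.
move=> _ [U oU <-]; rewrite setTI.
rewrite (_ : _ @^-1` U = \bigcup_(n in
    [set n : nat * nat | V n.1 `*` V n.2 `<=`
       (fun p : borel G * borel G => (p.1 - p.2)%R : borel G) @^-1` U])
    (V n.1 `*` V n.2)).
  rewrite bigcup_mkcond; apply: countable_bigcupT_measurable => // n.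
  case: ifP => // _.
  by apply: measurableX; exact: open_borel_measurable.
apply/seteqP; split => [[x y] Uxy|p [n nU np]]; last exact: nU.
have : nbhs (x, y)
    ((fun p : borel G * borel G => (p.1 - p.2)%R : borel G) @^-1` U).
  exact: (@sub_continuous (borel G) (x, y) U (open_nbhs_nbhs (conj oU Uxy))).
case=> -[A1 A2] /= [/bV[n1 [n1x n1A]] /bV[n2 [n2y n2A]]] AU.
exists (n1, n2) => //= -[a b] /= [/n1A aA /n2A bA].
exact: (AU (a, b)).
Qed.

Lemma measurable_fun_opp :
  measurable_fun [set: borel G] (fun x : borel G => (- x)%R : borel G).
Proof.
rewrite (_ : (fun _ => _) = (fun p : borel G * borel G => (p.1 - p.2)%R : borel G)
  \o (fun x : borel G => ((0%R : borel G), x))); last first.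
  by apply/funext => x /=; rewrite add0r.
apply: measurableT_comp; first exact: measurable_fun_sub.
exact: measurable_fun_pair.
Qed.

Lemma measurable_fun_add :
  measurable_fun [set: borel G * borel G]
    (fun p : borel G * borel G => (p.1 + p.2)%R : borel G).
Proof.
rewrite (_ : (fun _ => _) = (fun p : borel G * borel G => (p.1 - p.2)%R : borel G)
  \o (fun p => (p.1, - p.2)%R)); last first.
  by apply/funext => x /=; rewrite opprK.
apply: measurableT_comp; first exact: measurable_fun_sub.
apply: measurable_fun_pair; first exact: measurable_fst.
by apply: measurableT_comp; [exact: measurable_fun_opp|exact: measurable_snd].
Qed.

Lemma measurable_fun_borelB d (X : measurableType d) (f g : X -> borel G) :
  measurable_fun [set: X] f -> measurable_fun [set: X] g ->
  measurable_fun [set: X] (fun x => (f x - g x)%R : borel G).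
Proof.
move=> mf mg.
exact: (measurableT_comp measurable_fun_sub (measurable_fun_pair mf mg)).
Qed.

Lemma measurable_fun_borelN d (X : measurableType d) (f : X -> borel G) :
  measurable_fun [set: X] f -> measurable_fun [set: X] (fun x => (- f x)%R : borel G).
Proof. by move=> mf; exact: (measurableT_comp measurable_fun_opp mf). Qed.

Lemma measurable_fun_borelD d (X : measurableType d) (f g : X -> borel G) :
  measurable_fun [set: X] f -> measurable_fun [set: X] g ->
  measurable_fun [set: X] (fun x => (f x + g x)%R : borel G).
Proof.
move=> mf mg.
exact: (measurableT_comp measurable_fun_add (measurable_fun_pair mf mg)).
Qed.

(** The members of a countable base contained in some compact set cover [G], by
    local compactness; they are then made disjoint. *)
Lemma sigma_compact_partition : exists D : nat -> set (borel G),
  [/\ forall n, measurable (D n), trivIset setT D, \bigcup_n D n = setT &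
      forall n, exists2 K, compact K & D n `<=` K].
Proof.
have [V [oV bV]] := countable_base.
case: (hG) => lc _ _.
pose D n := if `[< exists2 K, compact K & V n `<=` K >] then V n else set0.
have mD n : measurable (D n).
  by rewrite /D; case: ifP => // _; exact: open_borel_measurable.
have DK n : exists2 K, compact K & D n `<=` K.
  rewrite /D; case: ifP => [/asboolP//|_].
  by exists set0 => //; exact: compact0.
exists (seqDU D); split.
- exact: seqDU_measurable.
- exact: trivIset_seqDU.
- rewrite -seqDU_bigcup_eq; apply/seteqP; split => // x _.
  have [K xK [cK _]] := lc x I.
  have {}xK : nbhs (x : borel G) K.
    by move: xK; rewrite /within /=; apply: filterS => y; exact.
  have [n [nx nK]] := bV x K xK.
  exists n => //; rewrite /D; case: ifP => // /negP; apply; apply/asboolP.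
  by exists K.
- move=> n; have [K cK DnK] := DK n; exists K => //.
  by apply: subset_trans DnK => x [].
Qed.

(** Finite intersections of members of a countable base. It allows countably many
    almost sure identities to determine a random measure. *)
Lemma countable_pi_system : exists V : nat -> set (borel G),
  [/\ forall n, measurable (V n), (exists n, V n = setT),
      setI_closed (range V) &
      (measurable : set (set (borel G))) = <<s range V >>].
Proof.
have [V [oV bV]] := countable_base.
(* The empty sequence codes the whole group. *)
pose W (s : seq nat) := \bigcap_(i in [set` s]) V i.
have oW s : open (W s).
  elim: s => [|i s IH].
    by rewrite (_ : W _ = setT) ?bigcap_set0//; [exact: openT|apply/seteqP; split].
  rewrite (_ : W _ = V i `&` W s); first exact: openI.
  apply/seteqP; split=> [x xW|x [xi xs] j /=].
    split; first by apply: xW; rewrite /= mem_head.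
    by move=> j js; apply: xW; rewrite /= inE js orbT.
  by rewrite inE => /predU1P[->//|/xs].
pose V' n := if unpickle n is Some s then W s else setT.
have V'p s : V' (pickle s) = W s by rewrite /V' pickleK.
have oV' n : open (V' n) by rewrite /V'; case: unpickle => // ; exact: openT.
exists V'; split.
- by move=> n; exact: open_borel_measurable.
- by exists (pickle ([::] : seq nat)); rewrite V'p; apply/seteqP; split.
- have rV' A : range V' A <-> exists s, A = W s.
    split=> [[n _ <-]|[s ->]]; last by exists (pickle s).
    rewrite /V'; case: unpickle => [s|]; first by exists s.
    by exists [::]; apply/seteqP; split.
  move=> A B /rV'[s ->] /rV'[t ->]; apply/rV'; exists (s ++ t).
  apply/seteqP; split => [x [xs xt] i /=|x xst].
    by rewrite mem_cat => /orP[/xs|/xt].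
  by split=> i /= is_; apply: xst; rewrite /= mem_cat is_ ?orbT.
- apply/seteqP; split; last first.
    apply: smallest_sub; first exact: sigma_algebra_measurable.
    by move=> _ [n _ <-]; exact: open_borel_measurable.
  apply: smallest_sub; first exact: smallest_sigma_algebra.
  move=> U oU.
  rewrite (_ : U = \bigcup_(n in [set n | V n `<=` U]) V n); last first.
    apply/seteqP; split => [x Ux|x [n nU /nU//]].
    by have [n [nx nU]] := bV x U (open_nbhs_nbhs (conj oU Ux)); exists n.
  rewrite bigcup_mkcond; apply: sigma_algebra_bigcup => n.
  case: ifP => _; last exact: sigma_algebra0.
  apply: sub_sigma_algebra; exists (pickle [:: n]) => //.
  rewrite V'p; apply/seteqP; split => x; first by apply; rewrite /= mem_head.
  by move=> nx i /=; rewrite inE => /eqP ->.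
Qed.

End borel_topology.

(** * S-finiteness of kernels *)

Section sfinite_kernels.
Context d d' (X : measurableType d) (Y : measurableType d') (R : realType).

(** Returning the same underlying family of measures, and not only one that agrees
    with it on measurable sets, allows the given kernel to be replaced by
    rewriting. *)
Lemma sfinite_kernel_package (k : R.-ker X ~> Y) (s : (R.-ker X ~> Y)^nat) :
  (forall n, measure_fam_uub (s n)) ->
  (forall x U, measurable U -> k x U = kseries s x U) ->
  exists k' : R.-sfker X ~> Y,
    (k' : X -> {measure set Y -> \bar R}) = (k : X -> {measure set Y -> \bar R}).
Proof.
move=> us ks.
pose H := isSFiniteKernel_subdef.Build d d' X Y R k (ex_intro2 _ _ s us ks).
pose k' : R.-sfker X ~> Y := HB.pack (k : X -> {measure set Y -> \bar R}) k H.
by exists k'.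
Qed.

Section finite_valued.
Variable k : R.-ker X ~> Y.
Hypothesis kfin : forall x, k x setT < +oo.

(** The part of [k] living on the points whose total mass is at least [n] and less
    than [n + 1]: it is uniformly bounded, and the slices add up to [k]. *)
Definition kslice (n : nat) (x : X) : {measure set Y -> \bar R} :=
  if (n%:R%:E <= k x setT < n.+1%:R%:E) then k x else mzero.

Let measurable_kslice n U : measurable U -> measurable_fun [set: X] (kslice n ^~ U).
Proof.
move=> mU; rewrite (_ : (fun _ => _) = (fun x =>
  if (n%:R%:E <= k x setT < n.+1%:R%:E) then k x U else 0)); last first.
  by apply/funext => x; rewrite /kslice; case: ifP.
have mkT : measurable_fun [set: X] (k ^~ setT) by exact: measurable_kernel.
apply: measurable_fun_ifT => //; last exact: measurable_kernel.
apply: measurable_and.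
  by apply: measurable_fun_lee.
by apply: measurable_fun_lte.
Qed.

HB.instance Definition _ n := isKernel.Build _ _ X Y R (kslice n) (measurable_kslice n).

Lemma finite_valued_kernel_sfinite : exists k' : R.-sfker X ~> Y,
  (k' : X -> {measure set Y -> \bar R}) = (k : X -> {measure set Y -> \bar R}).
Proof.
apply: (@sfinite_kernel_package k (fun n => kslice n : R.-ker X ~> Y)).
  move=> n; exists n.+1%:R => x; rewrite /= /kslice; case: ifP => [/andP[]//|_].
  by rewrite /mzero lte_fin ltr0n.
move=> x U mU; rewrite /kseries /= /mseries.
have fx : k x setT \is a fin_num by rewrite ge0_fin_numE.
have ge0x : (0 <= fine (k x setT))%R by rewrite fine_ge0.
pose m := Num.truncn (fine (k x setT)).
have mE n : (n%:R%:E <= k x setT < n.+1%:R%:E) = (n == m).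
  by rewrite -(fineK fx) lee_fin lte_fin -truncn_eq.
rewrite (@nneseriesD1 _ _ m xpredT)//.
rewrite /kslice mE eqxx eseries0 ?adde0// => n _ /= nm.
by rewrite mE (negbTE nm).
Qed.

End finite_valued.

End sfinite_kernels.

Section precomposition.
Context d d1 d' (X : measurableType d) (X1 : measurableType d1) (Y : measurableType d')
  (R : realType) (f : X1 -> X).

(** The measurability proof is an argument so that the kernel structures below can
    be inferred from the term. *)
Definition kprecomp (mf : measurable_fun [set: X1] f)
  (k : X -> {measure set Y -> \bar R}) (x : X1) : {measure set Y -> \bar R} := k (f x).

Hypothesis mf : measurable_fun [set: X1] f.

Section kernel.
Variable k : R.-ker X ~> Y.
Let mk U : measurable U -> measurable_fun [set: X1] (kprecomp mf k ^~ U).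
Proof.
by move=> mU; apply: (measurableT_comp (measurable_kernel k U mU)).
Qed.
HB.instance Definition _ := isKernel.Build _ _ X1 Y R (kprecomp mf k) mk.
End kernel.

Variable k : R.-sfker X ~> Y.

Let sfk : exists2 s : (R.-ker X1 ~> Y)^nat,
  forall n, measure_fam_uub (s n) &
  forall x U, measurable U -> kprecomp mf k x U = kseries s x U.
Proof.
have [s us ks] := sfinite_kernel_subdef k.
exists (fun n => kprecomp mf (s n) : R.-ker X1 ~> Y).
  by move=> n; have [r sr] := us n; exists r => x; exact: sr.
by move=> x U mU; rewrite /kprecomp ks.
Qed.

HB.instance Definition _ :=
  isSFiniteKernel_subdef.Build _ _ X1 Y R (kprecomp mf k) sfk.

End precomposition.

Section locally_finite_kernels.
Context (G : topologicalZmodType) (hG : lcsch G) (R : realType).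

Section restriction.
Context d (X : measurableType d) (k : R.-ker X ~> borel G).

Definition krestr (D : set (borel G)) (mD : measurable D) (x : X) :
  {measure set (borel G) -> \bar R} := mrestr (k x) mD.

Let mkrestr (D : set (borel G)) (mD : measurable D) U :
  measurable U -> measurable_fun [set: X] (krestr mD ^~ U).
Proof.
by move=> mU; apply: (measurable_kernel k (U `&` D)); exact: measurableI.
Qed.

HB.instance Definition _ (D : set (borel G)) (mD : measurable D) :=
  isKernel.Build _ _ X (borel G) R (krestr mD) (mkrestr mD).

(** No bound uniform in [x] is available, so the kernel is cut twice: along a
    countable partition of [G] into relatively compact sets, on which each [k x]
    is finite, and then by the value of the mass. *)
Lemma locally_finite_kernel_sfinite : (forall x, locally_finite (k x)) ->
  exists k' : R.-sfker X ~> borel G,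
    (k' : X -> {measure set (borel G) -> \bar R}) =
    (k : X -> {measure set (borel G) -> \bar R}).
Proof.
move=> lf; have [D [mD tD UD DK]] := sigma_compact_partition hG.
have /choice[s sE] : forall n, exists s : R.-sfker X ~> borel G,
    (s : X -> {measure set (borel G) -> \bar R}) = krestr (mD n).
  move=> n; apply: finite_valued_kernel_sfinite => x.
  rewrite /krestr /= /mrestr setTI; have [K cK DnK] := DK n.
  apply: le_lt_trans (lf x K cK); apply: le_measure => //; rewrite inE//.
  exact: compact_borel_measurable.
have [t ut tE] := sfinite_kernel_subdef (kseries s : R.-sfker X ~> borel G).
apply: (sfinite_kernel_package ut) => x U mU.
rewrite -tE// /kseries /= /mseries.
rewrite -[in LHS](setIT U) -UD setI_bigcupr measure_semi_bigcup.
- by apply: eq_eseriesr => n _; rewrite sE.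
- by move=> n; exact: measurableI.
- exact: trivIset_setIl.
- by apply: bigcup_measurable => n _; exact: measurableI.
Qed.

End restriction.

Lemma measurable_fun_lfmeasure_eval (B : set (borel G)) : measurable B ->
  measurable_fun [set: lfmeasure G R] (fun mu : lfmeasure G R => mu B).
Proof.
move=> mB _ A mA; apply: sub_sigma_algebra; exists B => //.
by exists A.
Qed.

Section random_measure.
Context d (Omega : measurableType d) (xi : {mfun Omega >-> lfmeasure G R}).

Definition random_measure_kernel (w : Omega) :
  {measure set (borel G) -> \bar R} := xi w.

Let mxi U : measurable U ->
  measurable_fun [set: Omega] (random_measure_kernel ^~ U).
Proof.
move=> mU; exact: (measurableT_comp (measurable_fun_lfmeasure_eval mU)).
Qed.

HB.instance Definition _ :=
  isKernel.Build _ _ Omega (borel G) R random_measure_kernel mxi.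

Lemma random_measure_sfinite : exists k : R.-sfker Omega ~> borel G,
  forall w, k w = xi w :> {measure set (borel G) -> \bar R}.
Proof.
have [k kE] := @locally_finite_kernel_sfinite _ Omega random_measure_kernel
  (fun w => @lfmeasureP G R (xi w)).
by exists k => w; rewrite kE.
Qed.
End random_measure.

Lemma locally_finite_sigma_finite (mu : {measure set (borel G) -> \bar R}) :
  locally_finite mu -> sigma_finite setT mu.
Proof.
move=> lf; have [D [mD tD UD DK]] := sigma_compact_partition hG.
exists D => // n; split => //; have [K cK DnK] := DK n.
apply: le_lt_trans (lf K cK); apply: le_measure => //; rewrite inE//.
exact: compact_borel_measurable.
Qed.

End locally_finite_kernels.

(** As [sfinite_kernel_package], for a sigma-finite measure. *)
Lemma sigma_finite_package d (X : measurableType d) (R : realType)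
    (mu : {measure set X -> \bar R}) : sigma_finite setT mu ->
  exists m : {sigma_finite_measure set X -> \bar R}, m = mu :> {measure set X -> \bar R}.
Proof.
move=> sf.
pose H1 := isSFinite.Build _ _ R mu (sfinite_measure_sigma_finite sf).
pose H2 := isSigmaFinite.Build _ _ R mu sf.
pose m : {sigma_finite_measure set X -> \bar R} :=
  HB.pack (mu : set X -> \bar R) mu H1 H2.
by exists m; apply: eq_measure.
Qed.

Section semidirect_product.
Context d d' (X : measurableType d) (Y : measurableType d') (R : realType).

Section constant_kernel.
Definition kcst (mu : {measure set X -> \bar R}) (_ : unit) :
  {measure set X -> \bar R} := mu.

Let mkcst (mu : {measure set X -> \bar R}) U :
  measurable U -> measurable_fun [set: unit] (kcst mu ^~ U).
Proof. by move=> _; exact: measurable_cst. Qed.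

HB.instance Definition _ mu := isKernel.Build _ _ unit X R (kcst mu) (mkcst mu).

Variable P : {sfinite_measure set X -> \bar R}.

Let sfkcst : exists2 s : (R.-ker unit ~> X)^nat,
  forall n, measure_fam_uub (s n) &
  forall x U, measurable U -> kcst P x U = kseries s x U.
Proof.
exists (fun n => kcst (sfinite_measure_seq P n) : R.-ker unit ~> X).
  move=> n; exists (fine (sfinite_measure_seq P n setT) + 1)%R => _ /=.
  have fs : sfinite_measure_seq P n setT \is a fin_num by exact: fin_num_measure.
  by rewrite /kcst EFinD fineK// lteDl// lte01.
by move=> x U mU; exact: sfinite_measure_seqP.
Qed.

HB.instance Definition _ :=
  isSFiniteKernel_subdef.Build _ _ unit X R (kcst P) sfkcst.
End constant_kernel.

(** The measure [P (dx) k x (dy)], obtained by composing kernels, so that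
    s-finiteness comes from the stability of s-finite kernels under
    composition: [P] is a kernel from a point, and [k] is followed by the Dirac
    kernel at [(x, y)] in order to remember [x]. *)
Lemma semidirect_measure (P : {sfinite_measure set X -> \bar R})
    (k : R.-sfker X ~> Y) :
  exists M : {sfinite_measure set (X * Y)%type -> \bar R},
    forall h : X * Y -> \bar R, (forall z, 0 <= h z) ->
      measurable_fun [set: X * Y] h ->
      \int[M]_z h z = \int[P]_x \int[k x]_y h (x, y).
Proof.
have mid : measurable_fun [set: X * Y] (@id (X * Y)%type) by exact: measurable_id.
pose kp : R.-sfker X ~> (X * Y)%type := k \; kdirac mid.
have ms : measurable_fun [set: unit * X] (@snd unit X) by exact: measurable_snd.
pose K : R.-sfker unit ~> (X * Y)%type := kcst P \; kprecomp ms kp.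
pose H := isSFinite.Build _ _ R (K tt) (sfinite_kernel_measure K tt).
pose M : {sfinite_measure set (X * Y)%type -> \bar R} := HB.pack (K tt : set _ -> \bar R) (K tt) H.
exists M => h h0 mh.
transitivity (\int[kcst P tt]_x \int[kprecomp ms kp (tt, x)]_z h z).
  exact: (integral_kcomp (kcst P) (kprecomp ms kp) tt h0 mh).
apply: eq_integral => x _.
transitivity (\int[k x]_y \int[kdirac mid (x, y)]_z h z).
  exact: (integral_kcomp k (kdirac mid) x h0 mh).
by apply: eq_integral => y _; rewrite integral_dirac// diracT mul1e.
Qed.

End semidirect_product.

(** * Haar measure *)

Section invariant_measures.
Context (G : topologicalZmodType) (hG : lcsch G) (R : realType).

Lemma measurable_fun_translate (s : borel G) :
  measurable_fun [set: borel G] (fun x : borel G => (x - s)%R : borel G).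
Proof.
by apply: (measurable_fun_borelB hG); [exact: measurable_id|exact: measurable_cst].
Qed.

Lemma shift_subE (B : set (borel G)) (s : borel G) :
  shift_sub B s = [set x | B (x + s)%R].
Proof.
apply/seteqP; split => [_ [b Bb <-] /=|x /= Bx]; first by rewrite subrK.
by exists (x + s)%R; rewrite ?addrK.
Qed.

(** The common form of every invariance hypothesis below, for random measures,
    transport kernels and Haar measure alike. *)
Lemma integral_shift (mu nu : {measure set (borel G) -> \bar R}) (s : borel G)
    (h : borel G -> \bar R) :
  (forall B : set (borel G), measurable B -> mu (shift_sub B s) = nu B) ->
  (forall t, 0 <= h t) -> measurable_fun [set: borel G] h ->
  \int[mu]_t h t = \int[nu]_t h (t - s)%R.
Proof.
move=> mn h0 mh.
have mt := measurable_fun_translate s.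
rewrite -[RHS](@ge0_integral_pushforward _ _ _ _ _ _ mt nu setT h)//.
apply: eq_measure_integral => A mA _; rewrite /pushforward /=.
have mA' := mt measurableT A mA; rewrite setTI in mA'.
transitivity (nu (+%R^~ (- s)%R @^-1` A)); last by [].
rewrite -mn//; congr (mu _); rewrite shift_subE.
by apply/seteqP; split => x /=; rewrite addrK.
Qed.

Section haar.
Variable lam : {sfinite_measure set (borel G) -> \bar R}.
Hypothesis lam_inv : forall (s : borel G) (B : set (borel G)),
  measurable B -> lam (shift_sub B s) = lam B.
Variables (C : set (borel G)) (mC : measurable C) (hC : 0 < lam C < +oo).

Lemma integral_translate (s : borel G) (h : borel G -> \bar R) :
  (forall t, 0 <= h t) -> measurable_fun [set: borel G] h ->
  \int[lam]_t h (t - s)%R = \int[lam]_t h t.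
Proof.
by move=> h0 mh; apply/esym/integral_shift => // B; exact: lam_inv.
Qed.

Lemma integral_indic_translate (s : borel G) :
  \int[lam]_t (\1_C (s + t)%R)%:E = lam C.
Proof.
have mI : measurable_fun [set: borel G] (fun t : borel G => (\1_C t : R)%:E) by exact: measurable_EFin_indic.
transitivity (\int[lam]_t (\1_C (t - (- s))%R : R)%:E).
  by apply: eq_integral => t _; rewrite opprK addrC.
rewrite (@integral_translate (- s)%R (fun t => (\1_C t : R)%:E))//.
by rewrite integral_indic// setIT.
Qed.

(** Multiply by [lam C] and write the product as the integral of
    [1_C x * h (x - y)] over [lam (dx) lam (dy)]; translating first in [y] and
    then, in the other order of integration, in [x], one gets [lam C] times
    either side. This avoids the uniqueness theorem for Haar measure. *)
Lemma integral_reflect (h : borel G -> \bar R) :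
  (forall t, 0 <= h t) -> measurable_fun [set: borel G] h ->
  \int[lam]_t h (- t)%R = \int[lam]_t h t.
Proof.
move=> h0 mh.
have mI : measurable_fun [set: borel G] (fun t : borel G => (\1_C t : R)%:E) by exact: measurable_EFin_indic.
have I0 t : 0 <= (\1_C t : R)%:E by rewrite lee_fin.
have m1 := @measurable_fst _ _ (borel G) (borel G).
have m2 := @measurable_snd _ _ (borel G) (borel G).
have mhN : measurable_fun [set: borel G] (fun t : borel G => h (- t)%R).
  by apply: (measurableT_comp mh); apply: (measurable_fun_borelN hG); exact: measurable_id.
have E : lam C * \int[lam]_t h (- t)%R = lam C * \int[lam]_t h t.
  transitivity (\int[lam]_x \int[lam]_y ((\1_C x)%:E * h (x - y)%R)).
    rewrite -[X in X * _](integral_indic_translate (0%R : borel G)).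
    under eq_integral do rewrite add0r.
    rewrite -ge0_integralZr//; last exact: integral_ge0.
    apply: eq_integral => x _; rewrite -(integral_translate x)//.
    rewrite -ge0_integralZl//; last first.
      apply: (measurableT_comp mhN).
      by apply: (measurable_fun_borelB hG); [exact: measurable_id|exact: measurable_cst].
    by apply: eq_integral => y _; rewrite opprB.
  rewrite (@sfinite_Fubini _ _ _ _ _ lam lam (fun p => (\1_C p.1)%:E * h (p.1 - p.2)%R))/=.
  - transitivity (\int[lam]_y \int[lam]_x ((\1_C (x + y)%R)%:E * h x)).
      apply: eq_integral => y _.
      rewrite -[RHS](integral_translate y)//.
      + by apply: eq_integral => x _; rewrite subrK.
      + by move=> x; rewrite mule_ge0.
      + apply: emeasurable_funM => //; apply: (measurableT_comp mI).
        by apply: (measurable_fun_borelD hG); [exact: measurable_id|exact: measurable_cst].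
    rewrite (@sfinite_Fubini _ _ _ _ _ lam lam (fun p => (\1_C (p.2 + p.1)%R)%:E * h p.2))/=.
    + rewrite -ge0_integralZl//.
      apply: eq_integral => x _; rewrite -(integral_indic_translate x).
      rewrite -ge0_integralZr//.
      apply: (measurableT_comp mI).
      by apply: (measurable_fun_borelD hG); [exact: measurable_cst|exact: measurable_id].
    + by move=> p; rewrite mule_ge0.
    + apply: emeasurable_funM; last exact: measurableT_comp.
      by apply: (measurableT_comp mI); apply: (measurable_fun_borelD hG).
  - by move=> p; rewrite mule_ge0.
  - apply: emeasurable_funM; first exact: (measurableT_comp mI).
    by apply: (measurableT_comp mh); apply: (measurable_fun_borelB hG).
exact: (mule_cancelI hC E).
Qed.

End haar.
End invariant_measures.

(** * Mass transport *)

Section mass_transport.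
Context (G : topologicalZmodType) (hG : lcsch G) (R : realType).
Variable lam : {sfinite_measure set (borel G) -> \bar R}.
Hypothesis lam_inv : forall (s : borel G) (B : set (borel G)),
  measurable B -> lam (shift_sub B s) = lam B.
Variables (C : set (borel G)) (mC : measurable C) (hC : 0 < lam C < +oo).

Context dX dZ (X : measurableType dX) (Z : measurableType dZ).
Variable M : {sfinite_measure set X -> \bar R}.
Variable tau : borel G -> X -> X.
Hypothesis M_inv : forall u (h : X -> \bar R), (forall x, 0 <= h x) ->
  measurable_fun [set: X] h -> \int[M]_x h (tau u x) = \int[M]_x h x.
Variables (p q : X -> borel G) (g : X -> Z).
Hypotheses (mp : measurable_fun [set: X] p) (mq : measurable_fun [set: X] q)
  (mg : measurable_fun [set: X] g).
Hypotheses (ptau : forall u x, p (tau u x) = (p x - u)%R)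
  (qtau : forall u x, q (tau u x) = (q x - u)%R)
  (gtau : forall u x, g (tau u x) = g x).

(** Here [tau] is a flow that preserves [M], the maps [p] and [q] attach to [x] two
    points of the group that move along with the flow, and [g] is constant on
    orbits. The factor [lam C] is written as the integral over [u] of
    [1_C (q x + u)]; shifting the system by [tau u] moves [u] from the argument
    of the indicator to that of [k], where the [u]-integral no longer depends on
    [p x]. *)
Lemma mass_transport (k : Z * borel G -> \bar R) : (forall z, 0 <= k z) ->
  measurable_fun [set: Z * borel G] k ->
  lam C * \int[M]_x k (g x, p x) =
  \int[M]_x ((\1_C (q x))%:E * \int[lam]_u k (g x, u)).
Proof.
move=> k0 mk.
have mI : measurable_fun [set: borel G] (fun t : borel G => (\1_C t : R)%:E) by exact: measurable_EFin_indic.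
have I0 t : 0 <= (\1_C t : R)%:E by rewrite lee_fin.
have mkgp : measurable_fun [set: X] (fun x => k (g x, p x)).
  exact: (measurableT_comp mk (measurable_fun_pair mg mp)).
have m1 := @measurable_fst _ _ X (borel G).
have m2 := @measurable_snd _ _ X (borel G).
transitivity (\int[M]_x \int[lam]_u (k (g x, p x) * (\1_C (q x + u)%R)%:E)).
  rewrite -ge0_integralZl//.
  apply: eq_integral => x _; rewrite ge0_integralZl//.
    by rewrite (integral_indic_translate hG lam_inv mC) muleC.
  apply: (measurableT_comp mI).
  by apply: (measurable_fun_borelD hG); [exact: measurable_cst|exact: measurable_id].
rewrite (@sfinite_Fubini _ _ _ _ _ M lam
  (fun z => k (g z.1, p z.1) * (\1_C (q z.1 + z.2)%R)%:E))/=; first last.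
- apply: emeasurable_funM; first exact: (measurableT_comp mkgp m1).
  apply: (measurableT_comp mI); apply: (measurable_fun_borelD hG) => //.
  exact: (measurableT_comp mq m1).
- by move=> z; rewrite mule_ge0.
transitivity (\int[lam]_u \int[M]_x (k (g x, p x - u)%R * (\1_C (q x))%:E)).
  apply: eq_integral => u _.
  rewrite -(@M_inv u).
  - by apply: eq_integral => x _; rewrite gtau ptau qtau subrK.
  - by move=> x; rewrite mule_ge0.
  - apply: emeasurable_funM => //; apply: (measurableT_comp mI).
    by apply: (measurable_fun_borelD hG) => //; exact: measurable_cst.
rewrite -(@sfinite_Fubini _ _ _ _ _ M lam
  (fun z => k (g z.1, p z.1 - z.2)%R * (\1_C (q z.1))%:E))/=; first last.
- apply: emeasurable_funM; last first.
    exact: (measurableT_comp mI (measurableT_comp mq m1)).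
  apply: (measurableT_comp mk); apply: measurable_fun_pair.
    exact: (measurableT_comp mg m1).
  by apply: (measurable_fun_borelB hG) => //; exact: (measurableT_comp mp m1).
- by move=> z; rewrite mule_ge0.
apply: eq_integral => x _.
have mkx : measurable_fun [set: borel G] (fun u : borel G => k (g x, u)).
  by apply: (measurableT_comp mk); apply: measurable_fun_pair => //; exact: measurable_cst.
have mkN : measurable_fun [set: borel G] (fun u : borel G => k (g x, (- u)%R)).
  by apply: (measurableT_comp mkx); apply: (measurable_fun_borelN hG); exact: measurable_id.
have mkB : measurable_fun [set: borel G] (fun u : borel G => k (g x, (p x - u)%R)).
  apply: (measurableT_comp mkx); apply: (measurable_fun_borelB hG).
    exact: measurable_cst.
  exact: measurable_id.
rewrite ge0_integralZr// muleC; congr (_ * _).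
rewrite -(integral_reflect hG lam_inv mC hC _ mkx)//.
rewrite -(integral_translate hG lam_inv (p x) _ mkN)//.
by apply: eq_integral => u _; rewrite opprB.
Qed.

End mass_transport.

(** * Stationary flows and invariant kernels *)

Section stationary_flow.
Context (G : topologicalZmodType) (hG : lcsch G) (R : realType).
Variable lam : {sigma_finite_measure set (borel G) -> \bar R}.
Hypothesis lam_inv : forall (s : borel G) (B : set (borel G)),
  measurable B -> lam (shift_sub B s) = lam B.
Context d (Omega : measurableType d) (theta : borel G -> Omega -> Omega).
Hypothesis htheta : measurable_flow theta.
Variable P : {sfinite_measure set Omega -> \bar R}.
Hypothesis hPstat : stationary theta P.

Lemma measurable_fun_flow d' (X : measurableType d') (a : X -> borel G) (b : X -> Omega) :
  measurable_fun [set: X] a -> measurable_fun [set: X] b ->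
  measurable_fun [set: X] (fun x => theta (a x) (b x)).
Proof.
case: htheta => mth _ _ ma mb.
exact: (measurableT_comp mth (measurable_fun_pair mb ma)).
Qed.

Lemma flowB s t w : theta (t - s)%R (theta s w) = theta t w.
Proof. by case: htheta => _ _ ->; rewrite subrK. Qed.

Lemma integral_stationary s (h : Omega -> \bar R) : (forall w, 0 <= h w) ->
  measurable_fun [set: Omega] h -> \int[P]_w h (theta s w) = \int[P]_w h w.
Proof.
move=> h0 mh.
have ms : measurable_fun [set: Omega] (theta s).
  by apply: measurable_fun_flow; [exact: measurable_cst|exact: measurable_id].
rewrite -[LHS](@ge0_integral_pushforward _ _ _ _ _ _ ms P setT h)//.
by apply: eq_measure_integral => A mA _; exact: hPstat.
Qed.

Definition invariant_kernel (zeta : Omega -> {measure set (borel G) -> \bar R}) :=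
  forall w (s : borel G) (B : set (borel G)),
    measurable B -> zeta (theta s w) (shift_sub B s) = zeta w B.

(** Mass transport with [p = q] the atom [t] of [zeta] and [g = theta_t w], the
    environment seen from that atom: the right-hand side depends on [zeta] only
    through its Palm measure. *)
Lemma refined_campbell (zeta : R.-sfker Omega ~> borel G) (C : set (borel G))
    (k : Omega * borel G -> \bar R) :
  invariant_kernel zeta -> measurable C -> 0 < lam C < +oo ->
  (forall z, 0 <= k z) -> measurable_fun [set: Omega * borel G] k ->
  lam C * \int[P]_w \int[zeta w]_t k (theta t w, t) =
  \int[P]_w \int[zeta w]_t ((\1_C t)%:E * \int[lam]_u k (theta t w, u)).
Proof.
move=> zinv mC hC k0 mk.
have [M ME] := semidirect_measure P zeta.
have m1 := @measurable_fst _ _ Omega (borel G).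
have m2 := @measurable_snd _ _ Omega (borel G).
have mI : measurable_fun [set: borel G] (fun t : borel G => (\1_C t : R)%:E) by exact: measurable_EFin_indic.
have mth : measurable_fun [set: Omega * borel G]
    (fun z : Omega * borel G => theta z.2 z.1) by exact: measurable_fun_flow.
pose tau (u : borel G) (z : Omega * borel G) : Omega * borel G :=
  (theta u z.1, (z.2 - u)%R).
have Minv u (h : Omega * borel G -> \bar R) : (forall z, 0 <= h z) ->
    measurable_fun [set: Omega * borel G] h ->
    \int[M]_z h (tau u z) = \int[M]_z h z.
  move=> h0 mh.
  have mht : measurable_fun [set: Omega * borel G] (fun z => h (tau u z)).
    apply: (measurableT_comp mh); apply: measurable_fun_pair.
      by apply: measurable_fun_flow => //; exact: measurable_cst.
    by apply: (measurable_fun_borelB hG) => //; exact: measurable_cst.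
  rewrite (ME (fun z => h (tau u z)) (fun z => h0 _) mht) (ME h h0 mh).
  rewrite -[RHS](@integral_stationary u (fun w => \int[zeta w]_y h (w, y))).
  - apply: eq_integral => w _; apply/esym/(integral_shift hG).
    + by move=> B mB; exact: zinv.
    + by move=> t; exact: h0.
    + by apply: (measurableT_comp mh); apply: measurable_fun_pair => //; exact: measurable_cst.
  - by move=> w; apply: integral_ge0 => t _; exact: h0.
  - exact: measurable_fun_integral_sfinite_kernel.
have := @mass_transport G hG R lam lam_inv C mC hC _ _ _ _ M tau Minv
  snd snd (fun z => theta z.2 z.1) m2 m2 mth _ _ _ k k0 mk.
rewrite !ME//=.
- apply => // u z /=; exact: flowB.
- by move=> z; rewrite mule_ge0// integral_ge0.
- apply: emeasurable_funM; first exact: (measurableT_comp mI).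
  have mF : measurable_fun [set: Omega] (fun w => \int[lam]_u k (w, u)).
    exact: (measurable_fun_fubini_tonelli_F _ mk k0).
  exact: (measurableT_comp mF mth).
- exact: (measurableT_comp mk (measurable_fun_pair mth m2)).
Qed.

Section transport.
Variables (xi : R.-sfker Omega ~> borel G) (T : R.-sfker (Omega * borel G) ~> borel G).
Hypotheses (xi_inv : invariant_kernel xi) (T_inv : invariant_transport_kernel theta T).

Lemma mkcomp_invariant : invariant_kernel (mkcomp xi T).
Proof.
move=> w s B mB; rewrite /mkcomp /kcomp.
transitivity (\int[xi w]_t T (theta s w, (t - s)%R) (shift_sub B s)); last first.
  by apply: eq_integral => t _; exact: T_inv.
apply: (@integral_shift G hG R (xi (theta s w)) (xi w) s
  (fun t => T (theta s w, t) (shift_sub B s))).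
- by move=> B' mB'; exact: xi_inv.
- by move=> t; exact: measure_ge0.
- have mB' : measurable (shift_sub B s).
    rewrite shift_subE.
    have : measurable_fun [set: borel G] (fun x : borel G => (x + s)%R : borel G).
      by apply: (measurable_fun_borelD hG); [exact: measurable_id|exact: measurable_cst].
    by move=> /(_ measurableT _ mB); rewrite setTI.
  exact: (measurableT_comp (measurable_kernel T _ mB')).
Qed.

Lemma integral_transport_shift w s (h : borel G -> \bar R) :
  (forall t, 0 <= h t) -> measurable_fun [set: borel G] h ->
  \int[T (theta s w, 0%R)]_t h t = \int[T (w, s)]_t h (t - s)%R.
Proof.
move=> h0 mh; apply: (integral_shift hG) => // B mB.
by rewrite -(T_inv s s w mB) subrr.
Qed.

(** Mass transport for a source [p = s] and a target [q = t]. The environment seen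
    from the target, [theta_t w], is constant along the flow, and the kernel
    [k (z, u) = f z * 1_B u] has Haar integral [f z * lam B]. *)
Lemma source_target_exchange (f : Omega -> \bar R) (B C : set (borel G)) :
  measurable B -> measurable C -> 0 < lam C < +oo ->
  (forall w, 0 <= f w) -> measurable_fun [set: Omega] f ->
  lam C * \int[P]_w \int[xi w]_s
    ((\1_B s)%:E * \int[T (w, s)]_t f (theta t w)) =
  lam B * \int[P]_w \int[mkcomp xi T w]_t ((\1_C t)%:E * f (theta t w)).
Proof.
move=> mB mC hC f0 mf.
have m1 := @measurable_fst _ _ Omega (borel G).
have m2 := @measurable_snd _ _ Omega (borel G).
have mI D : measurable D ->
    measurable_fun [set: borel G] (fun t : borel G => (\1_D t : R)%:E).
  exact: measurable_EFin_indic.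
pose X := ((Omega * (borel G * borel G))%type : measurableType _).
have n1 : measurable_fun [set: X] (fun x : X => x.1) by exact: measurable_fst.
have n2 : measurable_fun [set: X] (fun x : X => x.2) by exact: measurable_snd.
have ms : measurable_fun [set: X] (fun x : X => x.2.1).
  exact: (measurableT_comp measurable_fst n2).
have mt : measurable_fun [set: X] (fun x : X => x.2.2).
  exact: (measurableT_comp measurable_snd n2).
have mpr : measurable_fun [set: (Omega * borel G) * borel G]
    (fun z : (Omega * borel G) * borel G => (z.1.2, z.2)).
  apply: measurable_fun_pair; last exact: measurable_snd.
  exact: (measurableT_comp measurable_snd measurable_fst).
(* [xiT w] is the measure [xi w (ds) T (w, s) (dt)] on pairs (source, target). *)
pose K : R.-sfker (Omega * borel G) ~> (borel G * borel G)%type := T \; kdirac mpr.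
pose xiT : R.-sfker Omega ~> (borel G * borel G)%type := xi \; K.
have [M ME'] := semidirect_measure P xiT.
have xiTE w (h : borel G * borel G -> \bar R) : (forall y, 0 <= h y) ->
    measurable_fun [set: borel G * borel G] h ->
    \int[xiT w]_y h y = \int[xi w]_s \int[T (w, s)]_t h (s, t).
  move=> h0 mh.
  transitivity (\int[xi w]_s \int[K (w, s)]_y h y).
    exact: (integral_kcomp xi K w h0 mh).
  apply: eq_integral => s _.
  transitivity (\int[T (w, s)]_t \int[kdirac mpr ((w, s), t)]_y h y).
    exact: (integral_kcomp T (kdirac mpr) (w, s) h0 mh).
  by apply: eq_integral => t _; rewrite integral_dirac// diracT mul1e.
have ME (h : X -> \bar R) : (forall x, 0 <= h x) -> measurable_fun [set: X] h ->
    \int[M]_x h x = \int[P]_w \int[xi w]_s \int[T (w, s)]_t h (w, (s, t)).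
  move=> h0 mh; rewrite ME'//; apply: eq_integral => w _; rewrite xiTE//.
  by apply: (measurableT_comp mh); apply: measurable_fun_pair => //; exact: measurable_cst.
pose tau (u : borel G) (x : X) : X := (theta u x.1, ((x.2.1 - u)%R, (x.2.2 - u)%R)).
have Minv u (h : X -> \bar R) : (forall z, 0 <= h z) ->
    measurable_fun [set: X] h -> \int[M]_z h (tau u z) = \int[M]_z h z.
  move=> h0 mh.
  have mht : measurable_fun [set: X] (fun x => h (tau u x)).
    apply: (measurableT_comp mh); apply: measurable_fun_pair.
      by apply: measurable_fun_flow; [exact: measurable_cst|exact: n1].
    apply: measurable_fun_pair.
      by apply: (measurable_fun_borelB hG); [exact: ms|exact: measurable_cst].
    by apply: (measurable_fun_borelB hG); [exact: mt|exact: measurable_cst].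
  have mT : measurable_fun [set: Omega * borel G]
      (fun z => \int[T z]_t h (z.1, (z.2, t))).
    apply: (measurable_fun_integral_sfinite_kernel
      (fun y : (Omega * borel G) * borel G => h (y.1.1, (y.1.2, y.2)))).
      by move=> y; exact: h0.
    apply: (measurableT_comp mh); apply: measurable_fun_pair; last exact: mpr.
    exact: (measurableT_comp measurable_fst measurable_fst).
  rewrite (ME (fun x => h (tau u x)) (fun x => h0 _) mht) (ME h h0 mh).
  rewrite -[RHS](@integral_stationary u
    (fun w => \int[xi w]_s \int[T (w, s)]_t h (w, (s, t)))).
  - apply: eq_integral => w _.
    rewrite [RHS](@integral_shift G hG R (xi (theta u w)) (xi w) u
      (fun s => \int[T (theta u w, s)]_t h (theta u w, (s, t)))).
    + apply: eq_integral => s _; apply/esym/(integral_shift hG).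
      * by move=> D mD; exact: T_inv.
      * by move=> t; exact: h0.
      * apply: (measurableT_comp mh); apply: measurable_fun_pair.
          exact: measurable_cst.
        by apply: measurable_fun_pair; [exact: measurable_cst|exact: measurable_id].
    + by move=> D mD; exact: xi_inv.
    + by move=> s; apply: integral_ge0 => t _; exact: h0.
    + apply: (measurableT_comp mT).
      by apply: measurable_fun_pair; [exact: measurable_cst|exact: measurable_id].
  - by move=> w; apply: integral_ge0 => s _; apply: integral_ge0 => t _; exact: h0.
  - apply: (measurable_fun_integral_sfinite_kernel
      (fun z => \int[T z]_t h (z.1, (z.2, t)))); last exact: mT.
    by move=> z; apply: integral_ge0 => t _; exact: h0.
have mth : measurable_fun [set: X] (fun x : X => theta x.2.2 x.1).
  exact: measurable_fun_flow.
have mk : measurable_fun [set: Omega * borel G]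
    (fun z : Omega * borel G => (\1_B z.2)%:E * f z.1).
  apply: emeasurable_funM; first exact: (measurableT_comp (mI _ mB) m2).
  exact: (measurableT_comp mf m1).
have k0 (z : Omega * borel G) : 0 <= (\1_B z.2)%:E * f z.1.
  by rewrite mule_ge0// lee_fin.
have := @mass_transport G hG R lam lam_inv C mC hC _ _ X Omega M tau Minv
  (fun x => x.2.1) (fun x => x.2.2) (fun x => theta x.2.2 x.1) ms mt mth
  _ _ _ (fun z => (\1_B z.2)%:E * f z.1) k0 mk.
have mfk : measurable_fun [set: X] (fun x : X => (\1_B x.2.1)%:E * f (theta x.2.2 x.1)).
  apply: emeasurable_funM; first exact: (measurableT_comp (mI _ mB) ms).
  exact: (measurableT_comp mf mth).
have mfC : measurable_fun [set: X] (fun x : X => (\1_C x.2.2)%:E * f (theta x.2.2 x.1)).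
  apply: emeasurable_funM; first exact: (measurableT_comp (mI _ mC) mt).
  exact: (measurableT_comp mf mth).
have mfth w : measurable_fun [set: borel G] (fun t => f (theta t w)).
  by apply: (measurableT_comp mf); apply: measurable_fun_flow.
have lamB (a : \bar R) : 0 <= a -> \int[lam]_u ((\1_B u)%:E * a) = lam B * a.
  move=> a0; rewrite ge0_integralZr//; last exact: mI.
  by rewrite integral_indic// setIT.
have -> : \int[M]_x ((\1_B x.2.1)%:E * f (theta x.2.2 x.1)) =
  \int[P]_w \int[xi w]_s ((\1_B s)%:E * \int[T (w, s)]_t f (theta t w)).
  rewrite ME; [|by move=> x; rewrite mule_ge0// lee_fin|exact: mfk].
  apply: eq_integral => w _; apply: eq_integral => s _ /=.
  by rewrite ge0_integralZl.
move=> ->//; last 1 first.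
  by move=> u x /=; exact: flowB.
transitivity (\int[M]_x (lam B * ((\1_C x.2.2)%:E * f (theta x.2.2 x.1)))).
  by apply: eq_integral => x _ /=; rewrite lamB// muleCA.
rewrite ge0_integralZl//=; last by move=> x _; rewrite mule_ge0// lee_fin.
congr (_ * _); rewrite ME; [|by move=> x; rewrite mule_ge0// lee_fin|exact: mfC].
apply: eq_integral => w _; apply/esym.
apply: (integral_kcomp xi T w (f := fun t => (\1_C t)%:E * f (theta t w))).
  by move=> t; rewrite mule_ge0// lee_fin.
by apply: emeasurable_funM => //; exact: mI.
Qed.

End transport.

End stationary_flow.

(** * Integration against Palm measures *)

Section palm_integral.
Context (G : topologicalZmodType) (R : realType).
Variable lam : {measure set (borel G) -> \bar R}.
Context d (Omega : measurableType d) (theta : borel G -> Omega -> Omega).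
Hypothesis htheta : measurable_flow theta.
Variable P : {sfinite_measure set Omega -> \bar R}.

(** On measurable sets the Palm set function is the image under
    [(w, s) |-> theta_s w] of [P (dw) xi w (ds)] restricted to [Omega * B], scaled
    by the inverse of [lam B]. *)
Lemma integral_palm (xi : Omega -> lfmeasure G R) (k : R.-sfker Omega ~> borel G)
    (B : set (borel G)) (h : Omega -> \bar R) :
  (forall w, k w = xi w :> {measure set (borel G) -> \bar R}) ->
  measurable B -> 0 < lam B < +oo ->
  (forall w, 0 <= h w) -> measurable_fun [set: Omega] h ->
  \int[palm theta lam P B xi]_w h w =
  (lam B)^-1 * \int[P]_w \int[k w]_s ((\1_B s)%:E * h (theta s w)).
Proof.
move=> kxi mB /andP[B0 Boo] h0 mh.
have [M ME] := semidirect_measure P k.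
have m1 := @measurable_fst _ _ Omega (borel G).
have m2 := @measurable_snd _ _ Omega (borel G).
have mI D : measurable D ->
    measurable_fun [set: borel G] (fun t : borel G => (\1_D t : R)%:E).
  exact: measurable_EFin_indic.
have mth : measurable_fun [set: Omega * borel G]
    (fun z : Omega * borel G => theta z.2 z.1) by exact: measurable_fun_flow.
have mS : measurable ([set: Omega] `*` B) by exact: measurableX.
have Bf : lam B \is a fin_num by rewrite ge0_fin_numE.
have cE : (lam B)^-1 = (fine (lam B))^-1%:E.
  by rewrite -[in LHS](fineK Bf) inver gt_eqF// fine_gt0// B0.
have c0 : (0 <= (fine (lam B))^-1)%R by rewrite invr_ge0 fine_ge0.
have MB (f : Omega -> \bar R) : (forall w, 0 <= f w) -> measurable_fun [set: Omega] f ->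
    \int[mrestr M mS]_z f (theta z.2 z.1) =
    \int[P]_w \int[k w]_s ((\1_B s)%:E * f (theta s w)).
  move=> f0 mf; rewrite ge0_integral_mrestr//; last exact: measurableT_comp mf mth.
  rewrite -(ME (fun z => (\1_B z.2)%:E * f (theta z.2 z.1))); first last.
  - apply: emeasurable_funM; last exact: (measurableT_comp mf mth).
    exact: (measurableT_comp (mI _ mB) m2).
  - by move=> z; rewrite mule_ge0// lee_fin.
  rewrite integral_mkcond; apply: eq_integral => -[w s] _.
  rewrite patchE indicE /=.
  case: (boolP (s \in B)) => sB.
    by rewrite ifT ?mul1e// inE; split => //=; exact: set_mem.
  rewrite ifF ?mul0e//; apply/negP; rewrite inE => -[_ /=] /mem_set.
  exact/negP.
pose Q : {measure set Omega -> \bar R} := mscale (NngNum c0)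
  (measure_function_pushforward__canonical__measure_function_Measure (mrestr M mS) mth).
have QE (f : Omega -> \bar R) : (forall w, 0 <= f w) -> measurable_fun [set: Omega] f ->
    \int[Q]_w f w = (lam B)^-1 * \int[P]_w \int[k w]_s ((\1_B s)%:E * f (theta s w)).
  move=> f0 mf; rewrite ge0_integral_mscale// cE; congr (_ * _).
  rewrite -(MB f f0 mf).
  by rewrite (@ge0_integral_pushforward _ _ _ _ _ _ mth (mrestr M mS) setT f).
rewrite -(QE h h0 mh); apply: eq_set_function_integral => A mA.
transitivity (\int[Q]_w (\1_A w)%:E); last by rewrite integral_indic// setIT.
rewrite QE; first last.
- exact: measurable_EFin_indic.
- by move=> w; rewrite lee_fin.
rewrite /palm; congr (_ * _); apply: eq_integral => w _; rewrite -kxi.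
by apply: eq_integral => s _; rewrite EFinM muleC.
Qed.

End palm_integral.

(** * Identification of random measures almost everywhere *)

Section almost_everywhere.
Context d (X : measurableType d) (R : realType) (P : {measure set X -> \bar R}).
Hypothesis hP : sigma_finite [set: X] P.

(** Finiteness of [f] gives a countable cover by the sets where [f <= m], cut by
    sets of finite measure; on each of them [f] is integrable. *)
Lemma ae_eq_of_set_integrals (f g : X -> \bar R) :
  (forall x, 0 <= f x < +oo) -> measurable_fun [set: X] f ->
  measurable_fun [set: X] g ->
  (forall A, measurable A -> \int[P]_(x in A) f x = \int[P]_(x in A) g x) ->
  {ae P, forall x, f x = g x}.
Proof.
move=> f0 mf mg fg; case: hP => F UF mF.
pose E n m := F n `&` [set x | f x <= m%:R%:E].
have mE n m : measurable (E n m).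
  apply: measurableI; first exact: (mF n).1.
  by rewrite -[X in measurable X]setTI; exact: measurable_lee.
have aeE n m : {ae P, forall x, E n m x -> f x = g x}.
  apply: (@integral_ae_eq _ _ _ P (E n m) (mE n m) g f).
  - apply/integrableP; split; first exact: measurable_funTS.
    apply: (@le_lt_trans _ _ (\int[P]_(x in E n m) (m%:R)%:E)).
      apply: ge0_le_integral => //.
      + by apply: measurable_funTS; exact: measurableT_comp.
      + by move=> x [_ /= fm]; rewrite gee0_abs//; case/andP: (f0 x).
    rewrite integral_cst// lte_mul_pinfty//.
    apply: le_lt_trans (mF n).2; apply: le_measure; rewrite ?inE//.
      exact: (mF n).1.
    by move=> x [].
  - exact: measurable_funTS.
  - by move=> A _ mA; exact: fg.
have : {ae P, forall x, forall n m, E n m x -> f x = g x}.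
  by apply: ae_foralln => n; exact: ae_foralln.
apply: filterS => x Ex.
have : (\bigcup_n F n) x by rewrite -UF.
case=> n _ Fnx; case/andP: (f0 x) => f0x foo.
have ff : f x \is a fin_num by rewrite ge0_fin_numE.
apply: (Ex n (Num.truncn (fine (f x))).+1); split => //=.
rewrite -[leLHS]fineK// lee_fin ltW//.
by case/andP: (truncn_itv (fine_ge0 f0x)).
Qed.

End almost_everywhere.

Section kernel_ae_uniqueness.
Context (G : topologicalZmodType) (hG : lcsch G) (R : realType).
Context d (Omega : measurableType d) (P : {measure set Omega -> \bar R}).
Hypothesis hP : sigma_finite [set: Omega] P.

(** Relatively compact [D] is what makes [z2 w D] finite, hence allows its value to
    be identified almost everywhere. The null set must not depend on [B]: it is
    the union of those of the sets [V m `&` D n], where [V] lists a generating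
    pi-system and [D] partitions [G] into relatively compact sets. *)
Lemma ae_eq_kernel (z1 z2 : R.-ker Omega ~> borel G) :
  (forall w, locally_finite (z2 w)) ->
  (forall (A : set Omega) (D K : set (borel G)), measurable A -> measurable D ->
     compact K -> D `<=` K ->
     \int[P]_(w in A) z1 w D = \int[P]_(w in A) z2 w D) ->
  {ae P, forall w, forall B : set (borel G), measurable B -> z1 w B = z2 w B}.
Proof.
move=> lf z12.
have [D [mD tD UD DK]] := sigma_compact_partition hG.
have [V [mV [n0 Vn0] VI Vgen]] := countable_pi_system hG.
have finD w (n : nat) U : measurable U -> z2 w (U `&` D n) < +oo.
  move=> mU; have [K cK DnK] := DK n; apply: le_lt_trans (lf w K cK).
  apply: le_measure; rewrite ?inE//; first exact: measurableI.
    exact: compact_borel_measurable.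
  by move=> x [_ /DnK].
have : {ae P, forall w, forall n m, z2 w (V m `&` D n) = z1 w (V m `&` D n)}.
  apply: ae_foralln => n; apply: ae_foralln => m.
  have mVD : measurable (V m `&` D n) by exact: measurableI.
  apply: (ae_eq_of_set_integrals hP).
  - by move=> w; rewrite measure_ge0 finD.
  - exact: measurable_kernel.
  - exact: measurable_kernel.
  - move=> A mA; have [K cK DnK] := DK n; apply/esym/(z12 _ _ K) => //.
    by move=> x [_ /DnK].
apply: filterS => w zw B mB.
have eqD n U : measurable U -> z2 w (U `&` D n) = z1 w (U `&` D n).
  apply: (@measure_unique _ R (borel G) (range V) (fun=> setT) Vgen VI _ _
    (mrestr (z2 w) (mD n)) (mrestr (z1 w) (mD n))).
  - by move=> _; exists n0.
  - by apply/seteqP; split => // x _; exists 0%N.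
  - by move=> _ [m _ <-]; exact: zw.
  - by move=> _; exact: finD.
rewrite -(setIT B) -UD setI_bigcupr.
have tB : trivIset setT (fun n => B `&` D n) by exact: trivIset_setIl.
have mBD n : measurable (B `&` D n) by exact: measurableI.
have mUBD : measurable (\bigcup_n (B `&` D n)) by exact: bigcup_measurable.
rewrite !measure_semi_bigcup//.
by apply: eq_eseriesr => n _; rewrite eqD.
Qed.

End kernel_ae_uniqueness.

(** * Balancing and Palm measures *)

Section balancing.
Context (G : topologicalZmodType) (hG : lcsch G) (R : realType).
Variable lam : {sigma_finite_measure set (borel G) -> \bar R}.
Hypothesis lam_lf : locally_finite lam.
Hypothesis lam_inv : forall (s : borel G) (B : set (borel G)),
  measurable B -> lam (shift_sub B s) = lam B.
Context d (Omega : measurableType d) (theta : borel G -> Omega -> Omega).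
Hypothesis htheta : measurable_flow theta.
Variable P : {sigma_finite_measure set Omega -> \bar R}.
Hypothesis hPstat : stationary theta P.
Variables (xi eta : Omega -> lfmeasure G R) (kxi keta : R.-sfker Omega ~> borel G).
Hypotheses (kxiE : forall w, kxi w = xi w :> {measure set (borel G) -> \bar R})
  (ketaE : forall w, keta w = eta w :> {measure set (borel G) -> \bar R}).
Hypotheses (xi_inv : invariant_kernel theta kxi) (eta_inv : invariant_kernel theta keta).
Variable T : R.-sfker (Omega * borel G) ~> borel G.
Hypothesis T_inv : invariant_transport_kernel theta T.

Let mI (D : set (borel G)) : measurable D ->
  measurable_fun [set: borel G] (fun t : borel G => (\1_D t : R)%:E).
Proof. exact: measurable_EFin_indic. Qed.

(** Transporting the Palm measure of [xi] by [T] yields the Palm measure of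
    [mkcomp kxi T], here computed with the reference set [C]. *)
Lemma integral_palm_transport (B C : set (borel G)) (f : Omega -> \bar R) :
  measurable B -> 0 < lam B < +oo -> measurable C -> 0 < lam C < +oo ->
  (forall w, 0 <= f w) -> measurable_fun [set: Omega] f ->
  \int[palm theta lam P B xi]_w \int[T (w, 0%R)]_t f (theta t w) =
  (lam C)^-1 * \int[P]_w \int[mkcomp kxi T w]_t ((\1_C t)%:E * f (theta t w)).
Proof.
move=> mB hB mC hC f0 mf.
have mfth (w : Omega) : measurable_fun [set: borel G] (fun t => f (theta t w)).
  apply: (measurableT_comp mf); apply: (measurable_fun_flow htheta).
    exact: measurable_id.
  exact: measurable_cst.
have mTf : measurable_fun [set: Omega * borel G]
    (fun z => \int[T z]_t f (theta t z.1)).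
  apply: (measurable_fun_integral_sfinite_kernel
    (fun y : (Omega * borel G) * borel G => f (theta y.2 y.1.1))) => //.
  apply: (measurableT_comp mf); apply: (measurable_fun_flow htheta).
    exact: measurable_snd.
  exact: (measurableT_comp measurable_fst measurable_fst).
pose J := \int[P]_w \int[kxi w]_s ((\1_B s)%:E * \int[T (w, s)]_t f (theta t w)).
transitivity ((lam B)^-1 * J); last first.
  apply: (mule_cross hB hC).
  exact: (source_target_exchange hG lam_inv htheta hPstat xi_inv T_inv mB mC hC f0 mf).
have mT0 : measurable_fun [set: Omega] (fun w => \int[T (w, 0%R)]_t f (theta t w)).
  have mp : measurable_fun [set: Omega] (fun w : Omega => (w, (0%R : borel G))).
    by apply: measurable_fun_pair; [exact: measurable_id|exact: measurable_cst].
  exact: (measurableT_comp mTf mp).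
have T00 w : 0 <= \int[T (w, 0%R)]_t f (theta t w).
  by apply: integral_ge0 => t _; exact: f0.
rewrite (integral_palm htheta P kxiE mB hB T00 mT0).
apply: (congr1 (fun z => (lam B)^-1 * z)).
apply: eq_integral => w _; apply: eq_integral => s _.
apply: (congr1 (fun z => (\1_B s)%:E * z)).
rewrite (integral_transport_shift hG T_inv w s (fun t => f0 _) (mfth (theta s w))).
by apply: eq_integral => t _; rewrite (flowB htheta).
Qed.

Lemma balancing_palm (B C : set (borel G)) (f : Omega -> \bar R) :
  measurable B -> 0 < lam B < +oo -> measurable C -> 0 < lam C < +oo ->
  {ae P, forall w, forall D : set (borel G), measurable D ->
    mkcomp kxi T w D = keta w D} ->
  (forall w, 0 <= f w) -> measurable_fun [set: Omega] f ->
  \int[palm theta lam P B xi]_w \int[T (w, 0%R)]_t f (theta t w) =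
  \int[palm theta lam P C eta]_w f w.
Proof.
move=> mB hB mC hC bal f0 mf.
apply: (etrans (integral_palm_transport mB hB mC hC f0 mf)).
rewrite (integral_palm htheta P ketaE mC hC f0 mf).
apply: (congr1 (fun z => (lam C)^-1 * z)).
have mg : measurable_fun [set: Omega * borel G]
    (fun z : Omega * borel G => (\1_C z.2)%:E * f (theta z.2 z.1)).
  apply: emeasurable_funM; first exact: (measurableT_comp (mI mC) measurable_snd).
  apply: (measurableT_comp mf); apply: (measurable_fun_flow htheta).
    exact: measurable_snd.
  exact: measurable_fst.
have g0 (z : Omega * borel G) : 0 <= (\1_C z.2)%:E * f (theta z.2 z.1).
  by rewrite mule_ge0// lee_fin.
apply: ge0_ae_eq_integral => //.
- by apply: (measurable_fun_integral_sfinite_kernel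
    (fun z : Omega * borel G => (\1_C z.2)%:E * f (theta z.2 z.1))
    (kxi \; T : R.-sfker Omega ~> borel G)).
- by apply: (measurable_fun_integral_sfinite_kernel
    (fun z : Omega * borel G => (\1_C z.2)%:E * f (theta z.2 z.1)) keta).
- by move=> w _; apply: integral_ge0 => t _; exact: (g0 (w, t)).
- by move=> w _; apply: integral_ge0 => t _; exact: (g0 (w, t)).
- move: bal; apply: filterS => w bw _.
  by apply: eq_measure_integral => D mD _; exact: bw.
Qed.

(** Both [mkcomp kxi T] and [keta] are invariant, and by hypothesis their Palm
    measures coincide. *)
Lemma palm_balancing (B C : set (borel G)) :
  measurable B -> 0 < lam B < +oo -> measurable C -> 0 < lam C < +oo ->
  (forall f : Omega -> R, measurable_fun [set: Omega] f ->
     (forall w, (0 <= f w)%R) ->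
     \int[palm theta lam P B xi]_w \int[T (w, 0%R)]_t (f (theta t w))%:E =
     \int[palm theta lam P C eta]_w (f w)%:E) ->
  {ae P, forall w, forall D : set (borel G), measurable D ->
    mkcomp kxi T w D = keta w D}.
Proof.
move=> mB hB mC hC H.
apply: (@ae_eq_kernel G hG R d Omega P (sigma_finiteT P)
  (kxi \; T : R.-sfker Omega ~> borel G) keta).
  by move=> w; have := @lfmeasureP G R (eta w); rewrite -ketaE.
move=> A D K mA mD cK DK.
have lamD : lam D < +oo.
  apply: le_lt_trans (lam_lf cK); apply: le_measure; rewrite ?inE//.
  exact: compact_borel_measurable.
(* Chosen so that [k (theta t w, t)] is the product of [1_A w] and [1_D t]. *)
pose k (z : Omega * borel G) : \bar R := (\1_A (theta (- z.2)%R z.1) * \1_D z.2)%:E.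
have mk : measurable_fun [set: Omega * borel G] k.
  apply/measurable_EFinP; apply: measurable_funM.
    apply: measurableT_comp; first exact: measurable_indic.
    apply: (measurable_fun_flow htheta); last exact: measurable_fst.
    by apply: (measurable_fun_borelN hG); exact: measurable_snd.
  by apply: measurableT_comp; [exact: measurable_indic|exact: measurable_snd].
have k0 z : 0 <= k z by rewrite lee_fin mulr_ge0.
have kth w t : k (theta t w, t) = (\1_A w)%:E * (\1_D t)%:E.
  rewrite /k /=; case: htheta => _ th0 thD.
  by rewrite thD addNr th0 EFinM.
pose F (w : Omega) : \bar R := \int[lam]_u k (w, u).
have mF : measurable_fun [set: Omega] F.
  exact: (measurable_fun_fubini_tonelli_F _ mk k0).
have F0 w : 0 <= F w by apply: integral_ge0.
(* The hypothesis speaks of finite functions only; [D] lies in a compact set. *)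
have Ffin w : F w \is a fin_num.
  rewrite ge0_fin_numE//; apply: le_lt_trans lamD.
  rewrite -[leRHS]mul1e -(setIT D) -integral_indic// mul1e.
  apply: ge0_le_integral => //.
  - apply: (measurableT_comp mk); apply: measurable_fun_pair.
      exact: measurable_cst.
    exact: measurable_id.
  - exact: mI.
  - by move=> u _; rewrite /k lee_fin ler_piMl// indicE lern1 leq_b1.
have sw (zeta : R.-sfker Omega ~> borel G) : invariant_kernel theta zeta ->
    lam C * \int[P]_(w in A) zeta w D =
    \int[P]_w \int[zeta w]_t ((\1_C t)%:E * F (theta t w)).
  move=> zinv.
  rewrite -(refined_campbell hG lam_inv htheta hPstat zinv mC hC k0 mk).
  congr (_ * _); rewrite integral_mkcond; apply: eq_integral => w _.
  under [RHS]eq_integral do rewrite kth.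
  rewrite ge0_integralZl//; last exact: mI.
  rewrite integral_indic// setIT patchE indicE.
  by case: (w \in A); rewrite ?mul1e ?mul0e.
apply: (mule_cancelI hC); rewrite sw; last exact: (mkcomp_invariant hG xi_inv T_inv).
rewrite sw//; apply: (mule_cancelI (inve_between hC)).
rewrite -(integral_palm_transport mB hB mC hC F0 mF).
rewrite -(integral_palm htheta P ketaE mC hC F0 mF).
have FE : (fun w => (fine (F w))%:E) = F by apply/funext => w; rewrite fineK.
pose H_at (g : Omega -> \bar R) :=
  \int[palm theta lam P B xi]_w \int[T (w, 0%R)]_t g (theta t w) =
  \int[palm theta lam P C eta]_w g w.
rewrite -/(H_at F) -FE.
exact: (H (fine \o F) (measurableT_comp (fine_measurable _) mF) (fun w => fine_ge0 (F0 w))).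
Qed.

End balancing.

Theorem theorem4p1 (R : realType) (G : topologicalZmodType) (hG : lcsch G)
  (lambda : {measure set (borel G) -> \bar R}) (hlambda : haar_measure lambda)
  (d : measure_display) (Omega : measurableType d)
  (theta : borel G -> Omega -> Omega) (htheta : measurable_flow theta)
  (P : {measure set Omega -> \bar R})
  (hP : sigma_finite [set: Omega] P) (hPstat : stationary theta P)
  (xi eta : {mfun Omega >-> lfmeasure G R})
  (hxi : invariant_random_measure theta xi)
  (heta : invariant_random_measure theta eta)
  (T : R.-ker (Omega * borel G) ~> borel G)
  (hT : weighted_transport_kernel T) (hTinv : invariant_transport_kernel theta T)
  (B C : set (borel G))
  (mB : measurable B) (hB : 0 < lambda B < +oo)
  (mC : measurable C) (hC : 0 < lambda C < +oo) :
  ae_balancing P xi eta T <->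
  (forall f : Omega -> R, measurable_fun [set: Omega] f ->
     (forall w, (0 <= f w)%R) ->
     \int[palm theta lambda P B xi]_w
        \int[T (w, 0%R)]_t (f (theta t w))%:E =
     \int[palm theta lambda P C eta]_w (f w)%:E).

Proof.
case: hlambda => lam_lf lam0 lam_inv.
have [lam lamE] := sigma_finite_package (locally_finite_sigma_finite hG lam_lf).
have [Q QE] := sigma_finite_package hP.
subst lambda P.
have [kxi kxiE] := random_measure_sfinite hG xi.
have [keta ketaE] := random_measure_sfinite hG eta.
have [T' T'E] := locally_finite_kernel_sfinite hG (fun z => let: (w, s) := z in hT w s).
have TE z : T' z = T z :> {measure set (borel G) -> \bar R} by rewrite T'E.
have T'_inv : invariant_transport_kernel theta T'.
  by move=> s t w D mD; have := hTinv s t w D mD; rewrite -!TE.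
have kxi_inv : invariant_kernel theta kxi by move=> w s D mD; rewrite !kxiE; exact: hxi.
have keta_inv : invariant_kernel theta keta by move=> w s D mD; rewrite !ketaE; exact: heta.
have balE : ae_balancing Q xi eta T <->
    {ae Q, forall w, forall D : set (borel G), measurable D ->
      mkcomp kxi T' w D = keta w D}.
  have E w D : mkcomp kxi T' w D = \int[xi w]_s T (w, s) D.
    transitivity (\int[kxi w]_s T' (w, s) D); first by [].
    by rewrite kxiE; apply: eq_integral => s _; rewrite TE.
  by split; apply: filterS => w bw D mD; move: (bw D mD); rewrite E ketaE.
apply: (iff_trans balE); rewrite -T'E; split.
  move=> bal f mf f0.
  apply: (balancing_palm hG lam_inv htheta hPstat kxiE ketaE kxi_inv T'_inv mB hB mC hC bal).
    by move=> w; rewrite lee_fin.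
  exact/measurable_EFinP.
move=> H.
exact: (palm_balancing hG lam_lf lam_inv htheta hPstat kxiE ketaE kxi_inv keta_inv T'_inv
  mB hB mC hC H).
Qed.
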